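(* Let $m>1$, $\chi>0$, $N\ge 2$, and assume $\chi<C_N$. Let $X_0\in\mathcal R^N$ and let $X$ be the maximal solution in $\mathcal R^N$ of the gradient flow system with $X(0)=X_0$. Then the maximal time of existence of $X$ is $T=+\infty$.
   Context: $\mathcal R^p=\{X\in\mathbb R^p: X_1<X_2<\dots<X_p,\ \sum_{i=1}^pX_i=0\}$. For an integer $p\ge 2$, the constant $C_p>0$ is defined by $$\frac1{C_p}=\max_{X\in\mathcal R^p}\frac{\sum_{1\le i\ne j\le p}|X_j-X_i|^{1-m}}{\sum_{i=1}^{p-1}(X_{i+1}-X_i)^{1-m}}.$$ The gradient flow system is the ODE system, for $i=1,\dots,N$, $$\dot X_i=-(X_{i+1}-X_i)^{-m}+(X_i-X_{i-1})^{-m}+2\chi\sum_{j\ne i}\mathrm{sign}(j-i)\,|X_j-X_i|^{-m},$$ with the convention that the term $-(X_{i+1}-X_i)^{-m}$ is absent for $i=N$ and the term $(X_i-X_{i-1})^{-m}$ is absent for $i=1$. It is the Euclidean gradient flow $\dot X=-\nabla\mathcal F^N_m(X)$ of $\mathcal F^N_m(X)=\frac1{m-1}\sum_{i=1}^{N-1}(X_{i+1}-X_i)^{1-m}-\frac{\chi}{m-1}\sum_{1\le i\ne j\le N}|X_i-X_j|^{1-m}$. *)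

(* Defs.v *)
From HB Require Import structures.
From mathcomp Require Import all_boot all_order all_algebra.
From mathcomp Require Import all_classical all_reals all_analysis.
Set Implicit Arguments. Unset Strict Implicit. Unset Printing Implicit Defensive.
Import Order.TTheory GRing.Theory Num.Theory.
Import numFieldNormedType.Exports.
Local Open Scope classical_set_scope.
Local Open Scope ring_scope.

Section Defs.
Variable R : realType.

(* nat-indexed access to a vector x : 'I_N -> R (value 0 out of range, never used) *)
Definition ext (N : nat) (x : 'I_N -> R) (k : nat) : R :=
  match insub k with Some i => x i | None => 0 end.

Definition regionR (p : nat) (x : 'I_p -> R) : Prop :=
  (forall i j : 'I_p, (i < j)%N -> x i < x j) /\ \sum_(i < p) x i = 0.

Definition Cratio (m : R) (p : nat) (x : 'I_p -> R) : R :=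
  (\sum_(i < p) \sum_(j < p | j != i) `|x j - x i| `^ (1 - m)) /
  (\sum_(i < p | (i.+1 < p)%N) (ext x i.+1 - x i) `^ (1 - m)).

(* C_p : 1/C_p = max_{X in R^p} Cratio (the max is the sup) *)
Definition Cconst (m : R) (p : nat) : R :=
  (sup [set Cratio m x | x in regionR (p:=p)])^-1.

(* sign(j - i) for j != i *)
Definition sgnij (N : nat) (i j : 'I_N) : R := if (i < j)%N then 1 else -1.

Definition gf_field (m chi : R) (N : nat) (x : 'I_N -> R) (i : 'I_N) : R :=
  (if (i.+1 < N)%N then - (ext x i.+1 - x i) `^ (- m) else 0)
  + (if (0 < i)%N then (x i - ext x i.-1) `^ (- m) else 0)
  + 2 * chi * \sum_(j < N | j != i) sgnij i j * `|x j - x i| `^ (- m).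

Definition is_gf_solution (m chi : R) (N : nat) (X0 : 'I_N -> R)
    (T : \bar R) (X : R -> 'I_N -> R) : Prop :=
  (0%:E < T)%E /\ X 0 = X0 /\
  (forall t, 0 <= t -> (t%:E < T)%E -> regionR (X t)) /\
  (forall i, (fun s => X s i) @ at_right 0 --> X0 i) /\
  (forall t, 0 < t -> (t%:E < T)%E ->
     forall i, is_derive t 1 (fun s => X s i) (gf_field m chi (X t) i)).

End Defs.

(* Main.v *)
Require Import Defs.
From HB Require Import structures.
From mathcomp Require Import all_boot all_order all_algebra.
From mathcomp Require Import all_classical all_reals all_analysis.
From mathcomp Require Import ring lra.
Import Order.TTheory GRing.Theory Num.Theory.
Import numFieldNormedType.Exports.
Local Open Scope classical_set_scope.
Local Open Scope ring_scope.

(* Along a solution the free energy decreases, and chi < C_N makes it bound the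
   sum of the consecutive gaps to the power 1 - m; hence every gap stays above a
   constant d > 0 that depends only on X0. Truncating the power law below d / 2
   gives a bounded Lipschitz field, whose flow is global by Picard iteration.
   As the velocities are bounded, gaps above d stay above d / 2 for a fixed time,
   on which the truncated flow solves the true system, so its gaps are again
   above d: step by step, the truncated flow is a global solution. Any other
   solution also has gaps above d, hence follows the same truncated flow. *)

Set Implicit Arguments.
Unset Strict Implicit.

(** * Comparison by derivatives and limits *)

Lemma continuous_cvg_at_right (R : realType) (h : R -> R) (b : R) :
  {for b, continuous h} -> h @ b^'+ --> h b.
Proof. by move=> hc; apply: cvg_at_right_filter. Qed.

Lemma is_derive_continuous (R : realType) (h : R -> R) (t d : R) :
  is_derive t 1 h d -> {for t, continuous h}.
Proof.
by move=> [hd _]; apply: differentiable_continuous; apply/derivable1_diffP.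
Qed.

(** The mean value theorem for [k - h]. At the left end only a right limit is asked, since solutions
    are only known to be differentiable at positive times. *)
Lemma le_of_derive (R : realType) (h k dh dk : R -> R) (b a : R) :
  b <= a -> h @ b^'+ --> h b -> k @ b^'+ --> k b ->
  (forall s, b < s -> s <= a -> is_derive s 1 h (dh s)) ->
  (forall s, b < s -> s <= a -> is_derive s 1 k (dk s)) ->
  (forall s, b < s -> s <= a -> dh s <= dk s) ->
  h b <= k b -> h a <= k a.
Proof.
rewrite le_eqVlt => /predU1P[<- //|a0] h0 k0 hd kd le le0.
have gd (s : R) : b < s -> s <= a -> is_derive s 1 (k - h) (dk s - dh s).
  by move=> s0 sa; have := hd _ s0 sa; have := kd _ s0 sa; move=> *; exact: is_deriveB.
have gc (s : R) : b < s -> s <= a -> {for s, continuous (k - h)}.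
  by move=> s0 sa; exact: is_derive_continuous (gd _ s0 sa).
have cont : {within `[b, a], continuous (k - h)}.
  apply/continuous_within_itvP => //; split.
  - by move=> s /[!in_itv]/= /andP[s0 sa]; apply: gc => //; exact: ltW.
  - exact: cvgB.
  - by apply: cvg_at_left_filter; apply: gc.
have [|c /[!in_itv]/= /andP[c0 ca]] := @MVT _ (k - h) (fun s => dk s - dh s) b a a0 _ cont.
  by move=> s /[!in_itv]/= /andP[s0 sa]; apply: gd => //; exact: ltW.
rewrite !fctE => e.
have : 0 <= (dk c - dh c) * (a - b).
  by rewrite mulr_ge0 ?subr_ge0 ?le// ltW.
lra.
Qed.

Lemma abs_le_of_derive (R : realType) (h k dh dk : R -> R) (b a : R) :
  b <= a -> h @ b^'+ --> h b -> k @ b^'+ --> k b ->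
  (forall s, b < s -> s <= a -> is_derive s 1 h (dh s)) ->
  (forall s, b < s -> s <= a -> is_derive s 1 k (dk s)) ->
  (forall s, b < s -> s <= a -> `|dh s| <= dk s) ->
  `|h b| <= k b -> `|h a| <= k a.
Proof.
move=> a0 h0 k0 hd kd le le0; rewrite ler_norml; apply/andP; split; last first.
  apply: (le_of_derive a0 h0 k0 hd kd); last by rewrite (le_trans (ler_norm _)).
  by move=> s s0 sa; rewrite (le_trans (ler_norm _))// le.
rewrite lerNl.
apply: (@le_of_derive _ (- h) k (- dh) dk _ _ a0 _ k0 _ kd).
- by rewrite fctE; exact: cvgN.
- by move=> s s0 sa; have := hd _ s0 sa => ?; exact: is_deriveN.
- by move=> s s0 sa; rewrite (le_trans (ler_norm _))// normrN le.
- by rewrite (le_trans (ler_norm _))// normrN.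
Qed.

Lemma antiderivative (R : realType) (g : R -> R) : continuous g ->
  exists G : R -> R, [/\ G 0 = 0, G @ 0^'+ --> G 0 &
    forall t : R, 0 < t -> is_derive t 1 G (g t)].
Proof.
move=> gc.
(* Integrating from -1 rather than 0 makes 0 an interior point, so that continuity at 0 comes with
   differentiability. *)
pose F (x : R) : R := (\int[lebesgue_measure]_(t in `[(-1), x]) g t)%R.
have Fd (t : R) : -1 < t -> is_derive t 1 F (g t).
  move=> t1.
  have [//||d e] := @continuous_FTC1_closed R g (-1) t (t + 1) _ _ t1 (gc t).
  - by rewrite ltrDl.
  - apply: continuous_compact_integrable; first exact: segment_compact.
    exact: continuous_subspaceT.
  - by rewrite -e derive1E; apply: derivableP.
exists (F - cst (F 0)); split.
- by rewrite !fctE subrr.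
- apply: continuous_cvg_at_right; apply: continuousB; last exact: cst_continuous.
  by apply: is_derive_continuous (Fd 0 _); rewrite ltrN10.
- move=> t t0; have := Fd t (lt_trans _ t0); rewrite ltrN10 => /(_ isT) Ft.
  by apply: is_derive_eq; rewrite subr0.
Qed.

(** For positive [a], [2 ^ n] outgrows [c / a]. This turns the geometric bounds of the iteration
    into equalities. *)
Lemma le0_of_le_half_pow (R : realType) (a c : R) :
  (forall n, a <= c / 2 ^+ n) -> a <= 0.
Proof.
move=> ac; rewrite leNgt; apply/negP => a0.
have c0 : 0 < c by have := ac 0%N; rewrite expr0 divr1; apply: lt_le_trans.
set n := Num.truncn (c / a).
have : c / a < n.+1%:R by rewrite truncnS_gt.
rewrite ltr_pdivrMr// => h; have := ac n.+1; rewrite ler_pdivlMr ?exprn_gt0//.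
have : n.+1%:R <= 2 ^+ n.+1 :> R by rewrite -natrX ler_nat ltnW// ltn_expl.
move=> k l; have := ler_wpM2r (ltW a0) k; lra.
Qed.

(* The limit is the supremum of the lower bounds [u n - 2 c / 2 ^ n]. *)
Lemma geometric_limit (R : realType) (u : nat -> R) (c : R) :
  (forall n, `|u n.+1 - u n| <= c / 2 ^+ n) ->
  exists l, forall n, `|u n - l| <= 2 * c / 2 ^+ n.
Proof.
move=> uc.
(* The tail of the geometric series: the total of all increments from rank [n] on. *)
pose e n : R := 2 * c / 2 ^+ n.
have eS n : e n = e n.+1 + c / 2 ^+ n.
  by rewrite /e exprS; field; rewrite expf_neq0.
have lo : {homo (fun n => u n - e n) : x y / (x <= y)%N >-> x <= y}.
  apply: homo_leq => // [|n]; first exact: le_trans.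
  by have := uc n; rewrite (eS n) ler_norml => /andP[]; lra.
have hi : {homo (fun n => u n + e n) : x y / (x <= y)%N >-> y <= x}.
  apply: homo_leq => // [y x z xy yz|n]; first exact: le_trans yz xy.
  by have := uc n; rewrite (eS n) ler_norml => /andP[]; lra.
have e0 n : 0 <= e n.
  by have := le_trans (normr_ge0 _) (uc n); rewrite /e -mulrA => ?; rewrite mulr_ge0.
have lohi n k : u n - e n <= u k + e k.
  have := lo _ _ (leq_maxl n k); have := hi _ _ (leq_maxr n k).
  by have := e0 (maxn n k); lra.
pose A := range (fun n => u n - e n).
have supA : has_sup A.
  by split; [exists (u 0%N - e 0%N), 0%N|exists (u 0%N + e 0%N) => _ [n _ <-]].
exists (sup A) => n; rewrite -/(e n) ler_distl; apply/andP; split.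
  suff : sup A <= u n + e n by lra.
  by apply: ge_sup => [|_ [k _ <-]//]; case: supA.
suff : u n - e n <= sup A by lra.
by apply: ub_le_sup; [case: supA|exists n].
Qed.

(** * Picard iteration for a bounded Lipschitz field *)

Lemma dist_le_continuous (R : realType) (h : R -> R) (k : R) :
  (forall s t : R, `|h s - h t| <= k * `|s - t|) -> continuous h.
Proof.
move=> hk t; apply/cvgrPdist_lt => e e0; near=> s.
apply: le_lt_trans (hk t s) _.
have k1 : 0 < `|k| + 1 by rewrite ltr_wpDl.
apply: (@le_lt_trans _ _ ((`|k| + 1) * `|t - s|)).
  by rewrite ler_wpM2r// (le_trans (ler_norm _))// lerDl.
rewrite mulrC -ltr_pdivlMr//; near: s.
have : 0 < e / (`|k| + 1) by rewrite divr_gt0.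
by move: (e / _) => d d0; apply/nbhs_ballP; exists d.
Unshelve. all: by end_near. Qed.

Section Picard.
Variables (R : realType) (I : Type) (f : (I -> R) -> I -> R) (x0 : I -> R) (L B : R).
Hypothesis L_gt0 : 0 < L.
Hypothesis B_ge0 : 0 <= B.
Hypothesis f_bound : forall x i, `|f x i| <= B.
Hypothesis f_lip : forall x y (c : R), (forall j, `|x j - y j| <= c) ->
  forall i, `|f x i - f y i| <= L * c.

(** The Picard operator as a relation on [[0, a]]: [y] is [x0] plus the integral of [f (x t)], and
    solutions are the fixed points [drives a x x]. *)
Definition drives (a : R) (x y : R -> I -> R) :=
  [/\ y 0 = x0, forall i, y ^~ i @ 0^'+ --> x0 i &
    forall t : R, 0 < t -> t <= a -> forall i, is_derive t 1 (y ^~ i) (f (x t) i)].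

Lemma drives_right_continuous a x y (s : R) i : drives a x y -> 0 <= s -> s <= a ->
  y ^~ i @ s^'+ --> y s i.
Proof.
move=> [y0 yc yd]; rewrite le_eqVlt => /predU1P[<- _|s0 sa]; first by rewrite y0.
by apply: continuous_cvg_at_right; apply: is_derive_continuous; exact: yd.
Qed.

(** The velocity of [y] is a value of [f], hence bounded by [B]. This makes each iterate an
    admissible input of [drives_exists]. *)
Lemma drives_lipschitz a x y (s t : R) i : drives a x y ->
  0 <= s -> s <= t -> t <= a -> `|y t i - y s i| <= B * (t - s).
Proof.
move=> xy s0 st ta; have [_ _ yd] := xy.
apply: (@abs_le_of_derive _ (y ^~ i - cst (y s i)) (fun r => B * (r - s))
  (fun r => f (x r) i) (cst B) s t st).
- rewrite !fctE; apply: cvgB; last exact: cvg_cst.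
  by apply: (drives_right_continuous xy) => //; exact: le_trans ta.
- by apply: continuous_cvg_at_right => r; apply: cvgM; [exact: cvg_cst|
    apply: cvgB; [exact: cvg_id|exact: cvg_cst]].
- move=> r sr rt.
  have := yd r (le_lt_trans s0 sr) (le_trans rt ta) i => ?.
  by apply: is_derive_eq; rewrite subr0.
- move=> r sr rt; apply: is_derive_eq; rewrite /GRing.scale/=; ring.
- by move=> r _ _; exact: f_bound.
- by rewrite !fctE !subrr normr0 mulr0.
Qed.

(* The weight [expR (2 L s)] makes the integral operator a contraction with
   ratio 1/2 on every time interval. *)
Lemma drives_contraction a (c : R) x x' y y' : drives a x y -> drives a x' y' ->
  0 <= c ->
  (forall (s : R) i, 0 < s -> s <= a -> `|x s i - x' s i| <= c * expR (2 * L * s)) ->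
  forall (s : R) i, 0 <= s -> s <= a -> `|y s i - y' s i| <= c / 2 * expR (2 * L * s).
Proof.
move=> xy xy' c0 xx' s i s0 sa.
have [y0 yc yd] := xy; have [y0' yc' yd'] := xy'.
apply: (@abs_le_of_derive _ (y ^~ i - y' ^~ i) (fun r => c / 2 * expR (2 * L * r))
  (fun r => f (x r) i - f (x' r) i) (fun r => L * (c * expR (2 * L * r))) 0 s s0).
- by rewrite !fctE; apply: cvgB; rewrite ?y0 ?y0'.
- have dk : is_derive (0 : R) 1 (fun r : R => c / 2 * expR (2 * L * r)) (c / 2 * (2 * L)).
    by apply: is_derive_eq; rewrite /GRing.scale/= mulr0 expR0; ring.
  exact: continuous_cvg_at_right (is_derive_continuous dk).
- move=> r r0 rs; have ra := le_trans rs sa.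
  by have := yd r r0 ra i; have := yd' r r0 ra i => *; exact: is_deriveB.
- by move=> r r0 rs; apply: is_derive_eq; rewrite /GRing.scale/=; field.
- by move=> r r0 rs; apply: f_lip => j; apply: xx' => //; exact: le_trans sa.
- by rewrite !fctE y0 y0' subrr normr0 mulr_ge0 ?expR_ge0// divr_ge0.
Qed.

(** Two fixed points are within [2 * B * a] of each other by the Lipschitz bound; each use of the
    contraction halves this, so their distance is zero. *)
Lemma flow_unique a x x' : drives a x x -> drives a x' x' ->
  forall s : R, 0 <= s -> s <= a -> x s = x' s.
Proof.
move=> dx dx' s s0 sa; apply/funext => i.
have a0 := le_trans s0 sa.
have c0 : 0 <= 2 * B * a by rewrite !mulr_ge0// B_ge0.
have bound n : forall (s : R) j, 0 <= s -> s <= a ->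
    `|x s j - x' s j| <= 2 * B * a / 2 ^+ n * expR (2 * L * s).
  elim: n => [|n IH] {sa s0} s j s0 sa.
    have := drives_lipschitz j dx (lexx 0) s0 sa.
    have := drives_lipschitz j dx' (lexx 0) s0 sa.
    case: dx dx' => -> _ _ [-> _ _]; rewrite subr0 => h' h.
    have -> : x s j - x' s j = (x s j - x0 j) - (x' s j - x0 j) by ring.
    rewrite expr0 divr1 (le_trans (ler_normB _ _))//.
    have : 2 * B * a * 1 <= 2 * B * a * expR (2 * L * s).
      by rewrite ler_wpM2l// -expR0 ler_expR !mulr_ge0// ltW.
    have : B * s <= B * a by rewrite ler_wpM2l// B_ge0.
    lra.
  have -> : 2 * B * a / 2 ^+ n.+1 = 2 * B * a / 2 ^+ n / 2.
    by rewrite exprSr; field; rewrite expf_neq0.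
  apply: (drives_contraction dx dx') => //; first by rewrite divr_ge0// exprn_ge0.
  by move=> r k r0 ra; apply: IH => //; exact: ltW.
apply/eqP; rewrite -subr_eq0 -normr_le0.
apply: (@le0_of_le_half_pow _ _ (2 * B * a * expR (2 * L * s))) => n.
by rewrite mulrAC bound.
Qed.

Lemma drives_exists x :
  (forall (s t : R) i, 0 <= s -> s <= t -> `|x t i - x s i| <= B * (t - s)) ->
  exists y, forall a, drives a x y.
Proof.
move=> xlip.
(* Freezing [x] at its initial value for negative times keeps it Lipschitz, so the integrand is
   continuous on the whole line, as [antiderivative] requires. *)
have xl (s t : R) i : `|x (Num.max s 0) i - x (Num.max t 0) i| <= B * `|s - t|.
  have main (s' t' : R) : s' <= t' ->
      `|x (Num.max t' 0) i - x (Num.max s' 0) i| <= B * (t' - s').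
    move=> st; apply: le_trans (xlip _ _ i _ _) _.
    - by rewrite le_max lexx orbT.
    - by rewrite ge_max !le_max st lexx orbT.
    - rewrite ler_wpM2l ?B_ge0//.
      by rewrite /Num.max; case: ltP => ?; case: ltP => ?; lra.
  have [st|ts] := leP s t; last first.
    by rewrite [`|s - t|]ger0_norm ?subr_ge0 ?main// ltW.
  by rewrite distrC [`|s - t|]distrC [`|t - s|]ger0_norm ?subr_ge0 ?main.
have anti i : exists G : R -> R, [/\ G 0 = 0, G @ 0^'+ --> G 0 &
    forall t : R, 0 < t -> is_derive t 1 G (f (x (Num.max t 0)) i)].
  apply: antiderivative; apply: (@dist_le_continuous _ _ (L * B)) => s t.
  by rewrite -mulrA; apply: f_lip => j; exact: xl.
have [G Gp] := choice anti.
exists (fun t i => x0 i + G i t) => a; split.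
- by apply/funext => i; have [-> _ _] := Gp i; rewrite addr0.
- move=> i; have [G0 Gc _] := Gp i.
  have : (cst (x0 i) + G i) @ 0^'+ --> x0 i + G i 0 by apply: cvgD => //; exact: cvg_cst.
  by rewrite G0 addr0.
- move=> t t0 ta i; have [_ _ /(_ t t0) Gd] := Gp i.
  move: Gd; rewrite max_l ?ltW// => Gd.
  have : is_derive t 1 (cst (x0 i) + G i) (f (x t) i).
    by apply: is_derive_eq; rewrite add0r.
  by [].
Qed.

(** The iterates from the constant path converge geometrically, and by the contraction the image [y]
    of their limit [x] equals [x] at nonnegative times. The witness is [y], whose derivative is
    known. *)
Lemma flow_exists : exists x, forall a, drives a x x.
Proof.
pose lip (x : R -> I -> R) := forall (s t : R) i, 0 <= s -> s <= t ->
  `|x t i - x s i| <= B * (t - s).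
(* [S] is the Picard operator made total, with an arbitrary value on paths that are not
   Lipschitz. *)
have /choice[S SP] : forall x, exists y, lip x -> forall a, drives a x y.
  move=> x; have [/drives_exists[y yP]|h] := pselect (lip x); first by exists y.
  by exists x => /h.
pose u n := iter n S (fun=> x0).
have ulip n : lip (u n).
  elim: n => [|n IH] s t i s0 st.
    by rewrite subrr normr0 mulr_ge0 ?B_ge0 ?subr_ge0.
  exact: drives_lipschitz (SP (u n) IH t) s0 st (lexx t).
have uS n a : drives a (u n) (u n.+1) by exact: SP.
(* Chosen so that the first increment, at most [B * s = C * (2 * L * s)], is below
   [C * expR (2 * L * s)]. *)
pose C := B / (2 * L).
have C0 : 0 <= C by rewrite divr_ge0 ?B_ge0// mulr_ge0// ltW.
have uC n (s : R) i : 0 <= s -> `|u n.+1 s i - u n s i| <= C / 2 ^+ n * expR (2 * L * s).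
  elim: n s i => [|n IH] s i s0.
    have := drives_lipschitz i (uS 0%N s) (lexx 0) s0 (lexx s).
    have [-> _ _] := uS 0%N s; move=> /le_trans; apply.
    rewrite subr0 expr0 divr1.
    apply: (@le_trans _ _ (C * (2 * L * s))).
      by rewrite /C le_eqVlt; apply/predU1P; left; field; rewrite gt_eqF.
    by rewrite ler_wpM2l ?C0// (le_trans _ (expR_ge1Dx _))// lerDr.
  have -> : C / 2 ^+ n.+1 = C / 2 ^+ n / 2.
    by rewrite exprSr; field; rewrite expf_neq0.
  apply: (drives_contraction (uS n.+1 s) (uS n s)) => //.
    by rewrite divr_ge0 ?C0// exprn_ge0.
  by move=> r j r0 rs; apply: IH; exact: ltW.
have /choice[l lP] : forall si : R * I, exists l, 0 <= si.1 -> forall n,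
    `|u n si.1 si.2 - l| <= 2 * (C * expR (2 * L * si.1)) / 2 ^+ n.
  move=> [s i]/=; have [s0|s0] := leP 0 s; last by exists 0.
  have [|l lP] := @geometric_limit R (fun n => u n s i) (C * expR (2 * L * s)).
    by move=> n; rewrite mulrAC uC.
  by exists l.
pose x s i := l (s, i).
have ux n (s : R) i : 0 <= s -> `|u n s i - x s i| <= 2 * C / 2 ^+ n * expR (2 * L * s).
  by move=> s0; have /= := lP (s, i) s0 n; rewrite /x; congr (_ <= _); ring.
have xlip : lip x.
  move=> s t i s0 st; rewrite -subr_le0.
  apply: (@le0_of_le_half_pow _ _ (2 * C * expR (2 * L * s) + 2 * C * expR (2 * L * t))) => n.
  have := ux n s i s0; have := ux n t i (le_trans s0 st); have := ulip n s t i s0 st.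
  set p := expR (2 * L * s); set q := expR (2 * L * t).
  have -> : (2 * C * p + 2 * C * q) / 2 ^+ n = 2 * C / 2 ^+ n * p + 2 * C / 2 ^+ n * q.
    by ring.
  rewrite lerBlDr.
  rewrite !ler_norml => /andP[? ?] /andP[? ?] /andP[? ?].
  by apply/andP; split; lra.
have [y yP] := drives_exists xlip.
(* Both are close to the iterate of rank [n.+1]: [x] as the limit, [y] by the contraction applied to
   [u n] and [x]. *)
have yx (s : R) i : 0 <= s -> y s i = x s i.
  move=> s0; apply/eqP; rewrite -subr_eq0 -normr_le0.
  apply: (@le0_of_le_half_pow _ _ (2 * C * expR (2 * L * s))) => n.
  have := ux n.+1 s i s0.
  have uxn (r : R) j : 0 < r -> r <= s -> `|u n r j - x r j| <= 2 * C / 2 ^+ n * expR (2 * L * r).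
    by move=> r0 _; apply: ux; exact: ltW.
  have c0 : 0 <= 2 * C / 2 ^+ n by apply: divr_ge0; [exact: mulr_ge0|exact: exprn_ge0].
  have := drives_contraction (uS n s) (yP s) c0 uxn i s0 (lexx s).
  have -> : 2 * C / 2 ^+ n.+1 = 2 * C / 2 ^+ n / 2.
    by rewrite exprSr; field; rewrite expf_neq0.
  have -> : 2 * C * expR (2 * L * s) / 2 ^+ n = 2 * (2 * C / 2 ^+ n / 2 * expR (2 * L * s)).
    by field; rewrite expf_neq0.
  rewrite !ler_norml => /andP[? ?] /andP[? ?].
  by apply/andP; split; lra.
exists y => a; have [y0 yc yd] := yP a; split => // t t0 ta i.
have -> : y t = x t by apply/funext => j; rewrite yx ?ltW.
exact: yd.
Qed.

End Picard.

(** * The flow as a pair interaction *)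

Lemma ext_ord (R : realType) (N : nat) (x : 'I_N -> R) (k : 'I_N) : ext x k = x k.
Proof. by rewrite /ext valK. Qed.

(** The default value 0 of [ext] is what the sum gives when no index equals [k]. *)
Lemma sum_pred1_ext (R : realType) (N : nat) (F : 'I_N -> R) (k : nat) :
  \sum_(j < N) (k == j)%:R * F j = ext F k.
Proof.
rewrite /ext; case: insubP => [j _ jk|kN].
  rewrite (bigD1 j)//= jk eqxx mul1r big1 ?addr0// => l lj.
  by rewrite -jk (inj_eq val_inj) eq_sym (negbTE lj) mul0r.
rewrite big1// => j _; case: eqP => [kj|_]; last by rewrite mul0r.
by move: kN; rewrite kj ltn_ord.
Qed.

Lemma sum_neq_swap (R : realType) (N : nat) (F : 'I_N -> 'I_N -> R) :
  \sum_(i < N) \sum_(j < N | j != i) F i j = \sum_(i < N) \sum_(j < N | j != i) F j i.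
Proof.
rewrite (exchange_big_dep xpredT)//=; apply: eq_bigr => j _.
by apply: eq_bigl => i; rewrite eq_sym.
Qed.

Lemma norm_sum_le (R : realType) (N : nat) (P : pred 'I_N) (F : 'I_N -> R) (c : R) :
  (forall j, `|F j| <= c) -> `|\sum_(j < N | P j) F j| <= N%:R * c.
Proof.
move=> Fc; apply: le_trans (ler_norm_sum _ _ _) _; rewrite big_mkcond.
rewrite mulr_natl -[X in c *+ X]card_ord -sumr_const.
apply: ler_sum => j _; case: ifP => _ //.
exact: le_trans (Fc j).
Qed.

Section PairField.
Variables (R : realType) (N : nat) (chi : R).
Implicit Types (x : 'I_N -> R) (i j : 'I_N) (g : R -> R).

Lemma sgnij_opp i j : j != i -> sgnij R j i = - sgnij R i j.
Proof.
by rewrite /sgnij -(inj_eq val_inj)/=; case: ltngtP => // _ _; rewrite opprK.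
Qed.

Lemma norm_sgnij i j : `|sgnij R i j| = 1.
Proof. by rewrite /sgnij; case: ifP; rewrite ?normrN normr1. Qed.

Lemma sgnij_gap x i j : (forall i j, (i < j)%N -> x i < x j) -> j != i ->
  sgnij R i j * (x j - x i) = `|x j - x i|.
Proof.
move=> xinc; rewrite /sgnij -(inj_eq val_inj)/=; case: ltngtP => // ij _.
  by rewrite mul1r gtr0_norm// subr_gt0 xinc.
by rewrite mulN1r ltr0_norm// subr_lt0 xinc.
Qed.

Definition neighbours i j : bool := (i.+1 == j) || (j.+1 == i).

(* The nearest-neighbour repulsion and the attraction are one pair interaction,
   with this weight. *)
Definition weight i j : R := 2 * chi - (neighbours i j)%:R.

Lemma weightC i j : weight i j = weight j i.
Proof. by rewrite /weight /neighbours orbC. Qed.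

Lemma neighboursE i j : (neighbours i j)%:R = (i.+1 == j)%:R + (j.+1 == i)%:R :> R.
Proof.
rewrite /neighbours; case: eqP => [<-|_]; last by rewrite add0r.
by rewrite orTb gtn_eqF ?addr0.
Qed.

Definition pair_field g x i : R :=
  \sum_(j < N | j != i) sgnij R i j * weight i j * g `|x j - x i|.

(** A right neighbour has sign 1 and a left one sign -1, so the 1 subtracted from the weight of a
    neighbour yields both nearest-neighbour terms; those absent at the ends have no index [j]. *)
Lemma gf_fieldE m x i : (forall i j, (i < j)%N -> x i < x j) ->
  gf_field m chi x i = pair_field (fun s => s `^ (- m)) x i.
Proof.
move=> xinc; rewrite /gf_field /pair_field mulr_sumr.
pose F j := `|x j - x i| `^ (- m).
have nneq j : j != i -> (val j == val i) = false.
  by rewrite -(inj_eq val_inj) => /negbTE.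
(* The test [0 < i] stays in the second sum because [0.-1 = 0] would make the first particle its own
   neighbour. *)
transitivity ((\sum_(j < N) (i.+1 == j)%:R * - F j +
    \sum_(j < N) (if (0 < i)%N then (i.-1 == j)%:R * F j else 0)) +
    \sum_(j < N | j != i) 2 * chi * (sgnij R i j * F j)).
  congr (_ + _ + _).
  - rewrite sum_pred1_ext; case: ifPn => iN.
      rewrite -[i.+1]/(nat_of_ord (Ordinal iN)) !ext_ord /F gtr0_norm//.
      by rewrite subr_gt0; exact: xinc.
    by rewrite /ext insubF //; exact/negbTE.
  - case: ifPn => i0; last by rewrite big1.
    rewrite sum_pred1_ext.
    have iN : (i.-1 < N)%N by rewrite (leq_ltn_trans (leq_pred _)).
    rewrite -[i.-1]/(nat_of_ord (Ordinal iN)) !ext_ord /F distrC gtr0_norm//.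
    by rewrite subr_gt0 xinc//= ltn_predL.
rewrite -big_split/= (bigD1 i)//= [X in X + _ + _](_ : _ = 0) ?add0r.
  rewrite -big_split/=; apply: eq_bigr => j ji; rewrite /weight neighboursE.
  have -> : (if (0 < i)%N then (i.-1 == j)%:R * F j else 0) = (j.+1 == i)%:R * F j.
    case: (posnP i) => [->|i0]; first by rewrite (_ : (j.+1 == 0)%N = false) ?mul0r.
    by rewrite -[in RHS](prednK i0) eqSS eq_sym.
  rewrite /sgnij -/(F j); case: ltngtP (nneq j ji) => // ij _.
  - rewrite [j.+1 == i]gtn_eqF ?ltnS ?(ltnW ij)// mulr0n.
    by move: (_%:R : R) => a; ring.
  - rewrite [i.+1 == j]gtn_eqF ?ltnS ?(ltnW ij)// mulr0n.
    by move: (_%:R : R) => a; ring.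
rewrite gtn_eqF// mul0r add0r; case: ifPn => // i0.
by rewrite ltn_eqF ?mul0r// ltn_predL.
Qed.

(** Action equals reaction: the two orders of a pair give opposite terms. This keeps the centre of
    mass fixed. *)
Lemma sum_pair_field g x : \sum_(i < N) pair_field g x i = 0.
Proof.
have h : \sum_(i < N) pair_field g x i = - \sum_(i < N) pair_field g x i.
  rewrite /pair_field [LHS]sum_neq_swap -sumrN; apply: eq_bigr => i _.
  rewrite -sumrN; apply: eq_bigr => j ji.
  by rewrite sgnij_opp// (weightC j i) (distrC (x i)) !mulNr.
by lra.
Qed.

Lemma norm_weight i j : `|weight i j| <= 2 * `|chi| + 1.
Proof.
rewrite (le_trans (ler_normB _ _))// normrM (ger0_norm (ler0n _ 2)).
by rewrite lerD2l; case: neighbours; rewrite ?normr1 ?normr0.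
Qed.

Lemma pair_field_bound g b : (forall s, `|g s| <= b) ->
  forall x i, `|pair_field g x i| <= N%:R * ((2 * `|chi| + 1) * b).
Proof.
move=> gb x i; apply: norm_sum_le => j.
by rewrite !normrM norm_sgnij mul1r ler_pM// norm_weight.
Qed.

(** Moving every particle by at most [c] changes each distance by at most [2 * c], hence the last
    factor 2. *)
Lemma pair_field_lipschitz g l : 0 <= l ->
  (forall s t, `|g s - g t| <= l * `|s - t|) ->
  forall x y (c : R), (forall j, `|x j - y j| <= c) -> forall i,
  `|pair_field g x i - pair_field g y i| <= N%:R * ((2 * `|chi| + 1) * (l * 2)) * c.
Proof.
move=> l0 gl x y c xy i; rewrite /pair_field -sumrB -2!mulrA.
apply: norm_sum_le => j; rewrite -mulrBr !normrM norm_sgnij mul1r.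
rewrite ler_pM// ?norm_weight//.
apply: le_trans (gl _ _) _; rewrite -mulrA ler_wpM2l//.
apply: le_trans (ler_dist_dist _ _) _.
rewrite (_ : x j - x i - (y j - y i) = (x j - y j) - (x i - y i)); last by ring.
apply: le_trans (ler_normB _ _) _.
by have := xy i; have := xy j; lra.
Qed.

End PairField.

(** * The truncated power law *)

Section Truncation.
Variables (R : realType) (m d : R).
Hypotheses (m_gt1 : 1 < m) (d_gt0 : 0 < d).

Definition trunc_pow (s : R) : R := Num.max s d `^ (- m).

Lemma powRN_anti (r s t : R) : 0 <= r -> 0 < s -> s <= t -> t `^ (- r) <= s `^ (- r).
Proof.
move=> r0 s0 st; have t0 := lt_le_trans s0 st.
rewrite !powRN lef_pV2 ?posrE ?powR_gt0//.
by apply: ge0_ler_powR => //; rewrite nnegrE ltW.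
Qed.

Lemma trunc_powE s : d <= s -> trunc_pow s = s `^ (- m).
Proof. by move=> ds; rewrite /trunc_pow max_l. Qed.

Lemma trunc_pow_bound s : `|trunc_pow s| <= d `^ (- m).
Proof.
rewrite ger0_norm ?powR_ge0// powRN_anti ?le_max ?lexx ?orbT//.
by rewrite (le_trans ler01)// ltW.
Qed.

(** On [[d, +oo[] the derivative of the power is bounded by its size at [d], which is the constant
    here; clamping by [Num.max] does not increase distances. *)
Lemma trunc_pow_lipschitz s t :
  `|trunc_pow s - trunc_pow t| <= m * d `^ (- (m + 1)) * `|s - t|.
Proof.
pose l := m * d `^ (- (m + 1)).
have m0 : 0 <= m by rewrite (le_trans ler01)// ltW.
have l0 : 0 <= l by rewrite mulr_ge0// powR_ge0.
have main (a b : R) : d <= a -> a <= b -> `|b `^ (- m) - a `^ (- m)| <= l * (b - a).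
  move=> da ab; have a0 := lt_le_trans d_gt0 da.
  apply: (@abs_le_of_derive _ ((fun s => s `^ (- m)) - cst (a `^ (- m))) (fun r => l * (r - a))
    (fun r => - m * r `^ (- m - 1)) (cst l) a b ab).
  - apply: continuous_cvg_at_right; apply: continuousB; last exact: cst_continuous.
    exact: is_derive_continuous (is_derive1_powR _ a0).
  - apply: continuous_cvg_at_right => r; apply: cvgM; first exact: cvg_cst.
    by apply: cvgB; [exact: cvg_id|exact: cvg_cst].
  - move=> r ar _; have := is_derive1_powR (- m) (lt_trans a0 ar) => ?.
    by apply: is_derive_eq; rewrite subr0.
  - by move=> r _ _; apply: is_derive_eq; rewrite /GRing.scale/=; ring.
  - move=> r ar _; rewrite normrM normrN !ger0_norm ?powR_ge0//.
    rewrite ler_wpM2l// -opprD powRN_anti//; first lra.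
    by rewrite (le_trans da)// ltW.
  - by rewrite !fctE !subrr normr0 mulr0.
have main2 (a b : R) : a <= b -> `|trunc_pow b - trunc_pow a| <= l * (b - a).
  move=> ab; apply: le_trans (main _ _ _ _) _.
  - by rewrite le_max lexx orbT.
  - by rewrite ge_max !le_max ab lexx orbT.
  - by rewrite ler_wpM2l// /Num.max; case: ltP => ?; case: ltP => ?; lra.
rewrite -/l; have [st|/ltW ts] := leP s t.
  by rewrite distrC [`|s - t|]distrC [`|t - s|]ger0_norm ?subr_ge0 ?main2.
by rewrite [`|s - t|]ger0_norm ?subr_ge0 ?main2.
Qed.

End Truncation.

(** * Energy *)

Lemma is_derive_sum_cond (R : realType) (n : nat) (P : pred 'I_n) (h : 'I_n -> R -> R)
    (dh : 'I_n -> R) (t : R) :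
  (forall i, P i -> is_derive t 1 (h i) (dh i)) ->
  is_derive t 1 (fun s => \sum_(i < n | P i) h i s) (\sum_(i < n | P i) dh i).
Proof.
move=> hd; rewrite [X in is_derive _ _ _ X]big_mkcond/=.
have -> : (fun s => \sum_(i < n | P i) h i s) =
    \sum_(i < n) (if P i then h i else cst 0).
  apply/funext => s; rewrite fct_sumE big_mkcond/=; apply: eq_bigr => i _.
  by case: ifP.
apply: is_derive_sum => i; case: ifPn => [/hd //|_]; exact: is_derive_cst.
Qed.

(** Summation by parts: exchanging the indices turns the [v j] half into a copy of the [- v i] half,
    by antisymmetry of [a]. *)
Lemma sum_neq_antisym (R : realType) (N : nat) (a : 'I_N -> 'I_N -> R) (v : 'I_N -> R) :
  (forall i j, j != i -> a j i = - a i j) ->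
  \sum_(i < N) \sum_(j < N | j != i) a i j * (v j - v i) =
  - 2 * \sum_(i < N) v i * \sum_(j < N | j != i) a i j.
Proof.
move=> aN; pose S := \sum_(i < N) \sum_(j < N | j != i) a i j * v i.
have -> : \sum_(i < N) v i * (\sum_(j < N | j != i) a i j) = S.
  by apply: eq_bigr => i _; rewrite mulrC mulr_suml.
have SN : \sum_(i < N) \sum_(j < N | j != i) a i j * v j = - S.
  rewrite sum_neq_swap -sumrN; apply: eq_bigr => i _; rewrite -sumrN.
  by apply: eq_bigr => j ji; rewrite aN// mulNr.
transitivity (- S - S); last by ring.
rewrite -{1}SN /S -sumrB; apply: eq_bigr => i _; rewrite -sumrB.
by apply: eq_bigr => j _; rewrite mulrBr.
Qed.

Section Energy.
Variables (R : realType) (N : nat) (m chi : R).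
Hypotheses (m_gt1 : 1 < m) (chi_gt0 : 0 < chi) (N_ge2 : (2 <= N)%N)
  (chi_lt : chi < Cconst m N).
Implicit Types (x v : 'I_N -> R) (i j : 'I_N).

(* This is [- 2 (m - 1)] times the free energy, hence nondecreasing along the flow.
   On ordered configurations [sgnij R i j * (x j - x i)] is [`|x j - x i|]. *)
Definition energy x : R := \sum_(i < N) \sum_(j < N | j != i)
  weight chi i j * (sgnij R i j * (x j - x i)) `^ (1 - m).

Lemma sgnij_gap_gt0 x i j : (forall i j, (i < j)%N -> x i < x j) -> j != i ->
  0 < sgnij R i j * (x j - x i).
Proof.
move=> xinc ji; rewrite sgnij_gap// normr_gt0 subr_eq0.
move: ji; rewrite -(inj_eq val_inj)/=; case: ltngtP => // ij _.
  by rewrite lt_eqF ?xinc.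
by rewrite gt_eqF ?xinc.
Qed.

(** The gradient flow identity. The derivative is the pair sum of [(1 - m) * (a i j * (v j - v i))]
    with [a] antisymmetric, and summing [a i j] over [j] gives back the velocity [v i]. *)
Lemma energy_derive (X : R -> 'I_N -> R) (t : R) :
  (forall i j, (i < j)%N -> X t i < X t j) ->
  (forall i, is_derive t 1 (X ^~ i) (gf_field m chi (X t) i)) ->
  is_derive t 1 (fun s => energy (X s))
    (2 * (m - 1) * \sum_(i < N) gf_field m chi (X t) i ^+ 2).
Proof.
move=> Xinc Xd; pose v := gf_field m chi (X t).
pose a i j := sgnij R i j * weight chi i j * `|X t j - X t i| `^ (- m).
have vE i : v i = \sum_(j < N | j != i) a i j by exact: gf_fieldE.
have -> : 2 * (m - 1) * \sum_(i < N) gf_field m chi (X t) i ^+ 2 =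
    \sum_(i < N) \sum_(j < N | j != i) (1 - m) * (a i j * (v j - v i)).
  under [RHS]eq_bigr do rewrite -mulr_sumr.
  rewrite -mulr_sumr sum_neq_antisym; last first.
    by move=> i j ji; rewrite /a sgnij_opp// (weightC _ j) distrC !mulNr.
  rewrite (eq_bigr (fun i => v i * \sum_(j < N | j != i) a i j)); last first.
    by move=> i _; rewrite -vE expr2.
  by ring.
apply: is_derive_sum_cond => i _; apply: is_derive_sum_cond => j ji.
(* The signed gap is linear in the positions and positive at time [t], so the chain rule applies
   with no absolute value to differentiate. *)
have gd : is_derive t 1 (fun s => sgnij R i j * (X s j - X s i)) (sgnij R i j * (v j - v i)).
  have := Xd i; have := Xd j => dj di.
  have : is_derive t 1 (cst (sgnij R i j) * (X ^~ j - X ^~ i)) (sgnij R i j * (v j - v i)).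
    by apply: is_derive_eq; rewrite /GRing.scale/= mulr0 addr0.
  by [].
have pd := @is_derive1_comp R (fun s => s `^ (1 - m))
  (fun s => sgnij R i j * (X s j - X s i)) t _ _
  (is_derive1_powR (1 - m) (sgnij_gap_gt0 Xinc ji)) gd.
have : is_derive t 1 (cst (weight chi i j) *
    ((fun s => s `^ (1 - m)) \o (fun s => sgnij R i j * (X s j - X s i))))
    ((1 - m) * (a i j * (v j - v i))).
  apply: is_derive_eq; rewrite /GRing.scale/= mulr0 addr0 /a sgnij_gap//.
  by rewrite (_ : 1 - m - 1 = - m); ring.
by [].
Qed.

Lemma energy_right_continuous (X : R -> 'I_N -> R) :
  (forall i j, (i < j)%N -> X 0 i < X 0 j) ->
  (forall i, X ^~ i @ 0^'+ --> X 0 i) ->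
  (fun s => energy (X s)) @ 0^'+ --> energy (X 0).
Proof.
move=> Xinc Xc; apply: cvg_big; first exact: add_continuous.
move=> i _; apply: cvg_big; first exact: add_continuous.
move=> j ji.
apply: cvgM; first exact: cvg_cst.
have gc : (fun s => sgnij R i j * (X s j - X s i)) @ 0^'+ --> sgnij R i j * (X 0 j - X 0 i).
  by apply: cvgM; [exact: cvg_cst|apply: cvgB; exact: Xc].
have pc := is_derive_continuous (is_derive1_powR (1 - m) (sgnij_gap_gt0 Xinc ji)).
exact: (continuous_cvg _ pc gc).
Qed.

Lemma energy_ge (X0 : 'I_N -> R) (T : \bar R) (X : R -> 'I_N -> R) (t : R) :
  is_gf_solution m chi X0 T X -> 0 <= t -> (t%:E < T)%E -> energy X0 <= energy (X t).
Proof.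
move=> [T0 [X00 [Xreg [Xc Xd]]]] t0 tT.
have le_T (s : R) : s <= t -> (s%:E < T)%E by move=> st; rewrite (le_lt_trans _ tT)// lee_fin.
apply: (@le_of_derive _ (cst (energy X0)) (fun s => energy (X s)) (fun=> 0)
  (fun s => 2 * (m - 1) * \sum_(i < N) gf_field m chi (X s) i ^+ 2) 0 t t0).
- exact: cvg_cst.
- apply: energy_right_continuous; first by have [] := Xreg 0 (lexx 0) (le_T _ t0).
  by rewrite X00.
- move=> s s0 st; apply: energy_derive; last by apply: Xd; rewrite ?le_T.
  by have [] := Xreg s (ltW s0) (le_T _ st).
- move=> s _ _; rewrite mulr_ge0//; first by rewrite mulr_ge0// subr_ge0 ltW.
  by apply: sumr_ge0 => i _; exact: sqr_ge0.
- by rewrite X00.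
Qed.

(** The denominator and the numerator of [Cratio]. *)
Let S1 x := \sum_(i < N | (i.+1 < N)%N) (ext x i.+1 - x i) `^ (1 - m).
Let S2 x := \sum_(i < N) \sum_(j < N | j != i) `|x j - x i| `^ (1 - m).

(** The factor 2 of [S1] arises because the double sum meets each consecutive pair in both
    orders. *)
Lemma energyE x : (forall i j, (i < j)%N -> x i < x j) ->
  energy x = 2 * chi * S2 x - 2 * S1 x.
Proof.
move=> xinc; pose F i j := `|x j - x i| `^ (1 - m).
have FC i j : F i j = F j i by rewrite /F distrC.
have -> : energy x = 2 * chi * S2 x -
    \sum_(i < N) \sum_(j < N | j != i) (neighbours i j)%:R * F i j.
  rewrite /energy /S2 mulr_sumr -sumrB; apply: eq_bigr => i _.
  rewrite mulr_sumr -sumrB; apply: eq_bigr => j ji.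
  by rewrite sgnij_gap// /weight mulrBl.
have -> : S1 x = \sum_(i < N) \sum_(j < N | j != i) (i.+1 == j)%:R * F i j.
  rewrite /S1 big_mkcond; apply: eq_bigr => i _.
  have -> : \sum_(j < N | j != i) (i.+1 == j)%:R * F i j = ext (F i) i.+1.
    rewrite -sum_pred1_ext [RHS](bigD1 i)//= gtn_eqF// mul0r add0r; exact: eq_bigl.
  case: ifPn => iN; last by rewrite /ext insubF //; exact/negbTE.
  rewrite -[i.+1]/(nat_of_ord (Ordinal iN)) !ext_ord /F gtr0_norm//.
  by rewrite subr_gt0; exact: xinc.
congr (_ - _); rewrite mulr_natl mulr2n [X in _ = X + _]sum_neq_swap -big_split/=.
apply: eq_bigr => i _; rewrite -big_split/=; apply: eq_bigr => j ji.
by rewrite neighboursE mulrDl (FC j i) addrC.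
Qed.

Lemma consecutive_gap x i (iN : (i.+1 < N)%N) : ext x i.+1 - x i = x (Ordinal iN) - x i.
Proof. by rewrite -[i.+1]/(nat_of_ord (Ordinal iN)) ext_ord. Qed.

Lemma S1_ge x i : (i.+1 < N)%N -> (ext x i.+1 - x i) `^ (1 - m) <= S1 x.
Proof.
move=> iN; rewrite /S1 (bigD1 i)//= lerDl sumr_ge0// => j _; exact: powR_ge0.
Qed.

Lemma S1_gt0 x : (forall i j, (i < j)%N -> x i < x j) -> 0 < S1 x.
Proof.
move=> xinc; pose i0 : 'I_N := Ordinal (ltnW N_ge2).
apply: lt_le_trans (@S1_ge x i0 N_ge2).
rewrite powR_gt0// (@consecutive_gap x i0 N_ge2) subr_gt0; exact: xinc.
Qed.

(* [sup] is [0] on sets without a supremum, and then [Cconst] would be [0]. *)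
Lemma energy_coercive : exists2 c : R, 0 < c &
  forall x, regionR x -> c * S1 x <= - energy x.
Proof.
pose A := [set Cratio m x | x in regionR (p := N)].
have sA : 0 < sup A by rewrite -invr_gt0; exact: lt_trans chi_gt0 chi_lt.
have hA : has_sup A.
  by apply: contrapT => /sup_out e; move: sA; rewrite e ltxx.
have chis : chi * sup A < 1 by rewrite -ltr_pdivlMr// div1r.
(* By [energyE], [- energy x] is [2 * S1 x - 2 * chi * S2 x], and [S2 x <= sup A * S1 x] because
   [Cratio m x] lies below the supremum. *)
exists (2 * (1 - chi * sup A)); first by rewrite mulr_gt0// subr_gt0.
move=> x xreg; have [xinc _] := xreg.
have : Cratio m x <= sup A by apply: ub_le_sup; [case: hA|exists x].
rewrite /Cratio -/(S1 x) -/(S2 x) ler_pdivrMr ?S1_gt0// => h.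
rewrite energyE//; have := ler_wpM2l (ltW chi_gt0) h; lra.
Qed.

(** Coercivity keeps [S1] below [K], hence also each consecutive gap raised to the negative power
    [1 - m]; a small gap would exceed this. *)
Lemma gap_lower_bound (e : R) : exists2 d : R, 0 < d &
  forall x, regionR x -> e <= energy x -> forall i j, (i < j)%N -> d < x j - x i.
Proof.
have [c c0 cS] := energy_coercive.
(* The added 1 makes [K] positive and the bound on [S1] strict. *)
pose K := `|e| / c + 1.
have K0 : 0 < K by rewrite ltr_wpDl// divr_ge0// ltW.
exists (K `^ (1 - m)^-1); first exact: powR_gt0.
move=> x xreg ex i j ij; have [xinc _] := xreg.
have iN : (i.+1 < N)%N by exact: leq_ltn_trans ij (ltn_ord j).
(* The interval from [x i] to [x j] contains the gap between [i] and its successor, so that gap is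
   enough. *)
apply: (@lt_le_trans _ _ (x (Ordinal iN) - x i)); last first.
  rewrite lerD2r; have [<-//|ne] := eqVneq (Ordinal iN) j.
  apply/ltW/xinc; rewrite ltn_neqAle ij andbT; exact: ne.
rewrite ltNge; apply/negP => gapK.
have gap0 : 0 < x (Ordinal iN) - x i by rewrite subr_gt0 xinc/=.
have m1 : 0 <= m - 1 by rewrite subr_ge0 ltW.
have := powRN_anti m1 gap0 gapK.
rewrite opprB -powRrM mulVf; last by rewrite subr_eq0 lt_eqF.
rewrite (powRr1 (ltW K0)) -consecutive_gap => /le_trans/(_ (S1_ge x iN)); apply/negP; rewrite -ltNge.
have := cS x xreg; rewrite -ler_pdivlMl// => /le_lt_trans; apply.
rewrite mulrC /K ltr_pwDr// ler_pM2r ?invr_gt0//.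
by have := ler_norm (- e); rewrite normrN; lra.
Qed.

End Energy.

(** * Continuation *)

Section Wellposedness.
Variables (R : realType) (m chi : R) (N : nat) (X0 : 'I_N -> R) (d : R).
Hypotheses (m_gt1 : 1 < m) (N_ge2 : (2 <= N)%N) (d_gt0 : 0 < d).
Hypothesis X0_region : regionR X0.

(* [d / 2] is the truncation level: the a priori bound by [d] leaves a margin to
   extend the solution by a fixed time step. *)
Let f : ('I_N -> R) -> 'I_N -> R := pair_field chi (trunc_pow m (d / 2)).
Let B : R := N%:R * ((2 * `|chi| + 1) * (d / 2) `^ (- m)).
Let L : R := N%:R * ((2 * `|chi| + 1) * (m * (d / 2) `^ (- (m + 1)) * 2)).

Let d2_gt0 : 0 < d / 2. Proof. by rewrite divr_gt0. Qed.

Let m_gt0 : 0 < m. Proof. exact: lt_trans m_gt1. Qed.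

Let chi1_gt0 : 0 < 2 * `|chi| + 1 :> R. Proof. by rewrite ltr_wpDl// mulr_ge0. Qed.

Let B_ge0 : 0 <= B.
Proof. by rewrite !mulr_ge0 ?powR_ge0// ltW. Qed.

Let L_gt0 : 0 < L.
Proof. by rewrite !mulr_gt0 ?powR_gt0// ltr0n ltnW. Qed.

Let f_bound x i : `|f x i| <= B.
Proof. by apply: pair_field_bound => s; exact: trunc_pow_bound. Qed.

Let f_lip x y (c : R) : (forall j, `|x j - y j| <= c) ->
  forall i, `|f x i - f y i| <= L * c.
Proof.
apply: pair_field_lipschitz => [|s t]; last exact: trunc_pow_lipschitz.
by rewrite mulr_ge0 ?powR_ge0// ltW.
Qed.

Definition separated (e : R) (x : 'I_N -> R) := forall i j : 'I_N, (i < j)%N -> e <= x j - x i.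

Lemma separated_ordered e x : 0 < e -> separated e x ->
  forall i j : 'I_N, (i < j)%N -> x i < x j.
Proof. by move=> e0 sx i j ij; rewrite -subr_gt0 (lt_le_trans e0)// sx. Qed.

Lemma gf_field_separated x : separated (d / 2) x -> gf_field m chi x = f x.
Proof.
move=> sx; apply/funext => i; have xinc := separated_ordered d2_gt0 sx.
rewrite gf_fieldE//; apply: eq_bigr => j ji; rewrite trunc_powE//.
rewrite -(sgnij_gap xinc ji) /sgnij.
move: ji; rewrite -(inj_eq val_inj)/=; case: ltngtP => // ij _.
  by rewrite mul1r sx.
by rewrite mulN1r opprB sx.
Qed.

Lemma drives_of_gf_solution (T : \bar R) X (t : R) :
  is_gf_solution m chi X0 T X -> (t%:E < T)%E ->
  (forall s, 0 <= s -> s <= t -> separated (d / 2) (X s)) ->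
  drives f X0 t X X.
Proof.
move=> [T0 [X00 [_ [Xc Xd]]]] tT sep; split => // s s0 st i.
rewrite -gf_field_separated; last by apply: sep => //; exact: ltW.
by apply: Xd => //; rewrite (le_lt_trans _ tT)// lee_fin.
Qed.

(** Gaps of at least [d / 2] make the two fields agree, and the positions keep sum zero because the
    pair field sums to zero. *)
Lemma gf_solution_of_drives (T : \bar R) Y : (0%:E < T)%E ->
  (forall a, drives f X0 a Y Y) ->
  (forall s, 0 <= s -> (s%:E < T)%E -> separated (d / 2) (Y s)) ->
  is_gf_solution m chi X0 T Y.
Proof.
move=> T0 Yf sep; have [Y0 Yc _] := Yf 0.
have Yd (t : R) i : 0 < t -> is_derive t 1 (Y ^~ i) (f (Y t) i).
  by move=> t0; have [_ _ /(_ t t0 (lexx t))] := Yf t.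
split => //; split => //; split; last split => //.
- move=> t t0 tT; split; first by apply: separated_ordered d2_gt0 (sep _ t0 tT).
  apply/eqP; rewrite -normr_le0.
  apply: (@abs_le_of_derive _ (fun s => \sum_(i < N) Y s i) (fun=> 0) (fun=> 0) (fun=> 0) 0 t t0).
  + apply: cvg_big; first exact: add_continuous.
    by move=> i _; rewrite Y0; exact: Yc.
  + exact: cvg_cst.
  + move=> s s0 st.
    have := is_derive_sum_cond (P := xpredT) (fun i _ => Yd s i s0).
    by rewrite sum_pair_field.
  + by move=> s _ _; rewrite normr0.
  + by rewrite Y0; have [_ ->] := X0_region; rewrite normr0.
- by move=> t t0 tT i; rewrite gf_field_separated; [exact: Yd|apply: sep => //; exact: ltW].
Qed.

Hypothesis a_priori : forall (T : \bar R) X, is_gf_solution m chi X0 T X ->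
  forall t, 0 <= t -> (t%:E < T)%E -> separated d (X t).
Hypothesis X0_separated : separated d X0.

(** Bootstrap in time steps of length [h]: the bound [d / 2] before time [n%:R * h] makes [Y] a true
    solution there, so [a_priori] restores the bound [d], and this margin lasts one more step. *)
Lemma drives_separated Y : (forall a, drives f X0 a Y Y) ->
  forall t, 0 <= t -> separated (d / 2) (Y t).
Proof.
move=> Yf; have [Y0 _ _] := Yf 0.
(* A gap changes at speed at most [2 * B], so it loses at most [d / 2] within time [h]; the added 1
   covers [B = 0]. *)
pose h : R := d / 2 / (2 * B + 1).
have h0 : 0 < h by rewrite divr_gt0// ltr_wpDl// mulr_ge0.
have Bh : 2 * B * h <= d / 2.
  have : (2 * B + 1) * h = d / 2.
    by rewrite mulrC divfK// gt_eqF// ltr_wpDl// mulr_ge0.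
  by move=> <-; rewrite ler_wpM2r ?lerDl// ltW.
have step (s t : R) : 0 <= s -> s <= t -> t <= s + h -> separated d (Y s) ->
    separated (d / 2) (Y t).
  move=> s0 st tsh sep i j ij; have := sep i j ij.
  have := drives_lipschitz f_bound i (Yf t) s0 st (lexx t).
  have := drives_lipschitz f_bound j (Yf t) s0 st (lexx t).
  have : B * (t - s) <= B * h by rewrite ler_wpM2l//; lra.
  move: Bh; rewrite -mulrA; move: (B * h) (B * (t - s)) => Bh Bts.
  by rewrite !ler_norml => ? ? /andP[? ?] /andP[? ?] ?; lra.
have main n t : 0 <= t -> t < n%:R * h -> separated (d / 2) (Y t).
  elim: n t => [t t0|n IH t t0 tn]; first by rewrite mul0r ltNge t0.
  have [th|ht] := leP t h.
    by apply: (step 0) => //; [rewrite add0r|rewrite Y0].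
  have th0 : 0 <= t - h by rewrite subr_ge0 ltW.
  have thn : t - h < n%:R * h by move: tn; rewrite -natr1 mulrDl mul1r ltrBlDr.
  apply: (step (t - h)) => //; [by rewrite gerBl ltW|by rewrite subrK|].
  apply: (@a_priori (n%:R * h)%:E Y) => //.
  by apply: gf_solution_of_drives => //; rewrite lte_fin (le_lt_trans th0).
move=> t t0; apply: (main (Num.truncn (t / h)).+1) => //.
by rewrite -ltr_pdivrMr// truncnS_gt.
Qed.

Lemma gf_wellposed : exists Y : R -> 'I_N -> R,
  is_gf_solution m chi X0 +oo%E Y /\
  (forall (T : \bar R) X, is_gf_solution m chi X0 T X ->
    forall t, 0 <= t -> (t%:E < T)%E -> X t = Y t).
Proof.
have [Y Yf] := flow_exists X0 L_gt0 B_ge0 f_bound f_lip.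
have sepY := drives_separated Yf.
exists Y; split; first by apply: (gf_solution_of_drives (ltry 0) Yf) => s s0 _; exact: sepY.
move=> T X Xsol t t0 tT.
have sepX (s : R) : 0 <= s -> s <= t -> separated (d / 2) (X s).
  move=> s0 st i j ij; apply: le_trans (a_priori Xsol s0 _ ij).
    by have := d_gt0; lra.
  by rewrite (le_lt_trans _ tT)// lee_fin.
have dX := drives_of_gf_solution Xsol tT sepX.
exact: (flow_unique L_gt0 B_ge0 f_bound f_lip dX (Yf t) t0 (lexx t)).
Qed.

End Wellposedness.

Unset Implicit Arguments.
Set Strict Implicit.

(** Maximality is expressed through uniqueness: every solution is a restriction of the global [Y],
    so the maximal solution is [Y] and its existence time is infinite. *)
Theorem theorem1p3 (R : realType) (m chi : R) (N : nat) (X0 : 'I_N -> R) :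
  1 < m -> 0 < chi -> (2 <= N)%N -> chi < Cconst m N ->
  regionR X0 ->
  exists Y : R -> 'I_N -> R,
    is_gf_solution m chi X0 +oo%E Y /\
    (forall (T : \bar R) (X : R -> 'I_N -> R),
        is_gf_solution m chi X0 T X ->
        forall t, 0 <= t -> (t%:E < T)%E -> X t = Y t).
Proof.
move=> m_gt1 chi_gt0 N_ge2 chi_lt X0_region.
(* [energy] never falls below its initial value, so the [d] of this level serves every solution from
   [X0], and [X0] itself. *)
have [d d_gt0 gap] := gap_lower_bound m_gt1 chi_gt0 N_ge2 chi_lt (energy m chi X0).
apply: (@gf_wellposed _ m chi N X0 d) => //.
- move=> T X Xsol t t0 tT i j ij; apply/ltW/gap => //; last exact: energy_ge Xsol t0 tT.
  by have [_ [_ [Xreg _]]] := Xsol; exact: Xreg.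
- by move=> i j ij; apply/ltW/gap.
Qed.
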